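(* For all integers $k \geq 1$ and $n\ge 1$, $$T_{2k}(n) = \sum_{m=1}^k R(k,m) \binom{2n+m}{2m+1}.$$
   Context: For integers $k,n\ge 1$, $T_k(n) = 1^k + 3^k + \cdots + (2n-1)^k$ is the sum of the $k$th powers of the first $n$ odd positive integers. For integers $0 \le m \le k$, the numbers $R(k,m)$ (OEIS A304330) are defined by $$R(k,m) = \sum_{j=0}^m (-1)^j \binom{2m}{j} (m-j)^{2k},$$ with the convention $0^0=1$. Binomial coefficients $\binom{a}{b}$ with integers $0\le a<b$ are $0$. *)

(* Defs.v *)
From mathcomp Require Import all_boot all_order all_algebra.

Set Implicit Arguments.
Unset Strict Implicit.
Unset Printing Implicit Defensive.

Import GRing.Theory.

Local Open Scope ring_scope.

(* The truncated subtraction is exact, since 1 <= i. *)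
Definition oddPowerSum (k n : nat) : nat :=
  (\sum_(1 <= i < n.+1) (2 * i - 1) ^ k)%N.

(* OEIS A304330. The alternating sum is taken in int; it is meaningful for
   m <= k, and ^+ follows the convention 0 ^+ 0 = 1. *)
Definition R (k m : nat) : int :=
  \sum_(0 <= j < m.+1)
    (-1) ^+ j * ('C(2 * m, j))%:Z * (m%:Z - j%:Z) ^+ (2 * k).

(* Main.v *)
Require Import Defs.
From mathcomp Require Import all_boot all_order all_algebra.
From mathcomp Require Import ring zify.

Import GRing.Theory.

Local Open Scope ring_scope.

(** The numbers R(k,m) are, up to normalization, the central factorial numbers:
    for k >= 1, R(k,m) = (2m)! T(2k,2m) / 2, because in the full alternating
    sum of C(2m,j) (m-j)^(2k) over j <= 2m the terms j and 2m-j agree and the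
    middle one vanishes.  Hence the expansion of x^(2k) in central factorials
    x^2 (x^2-1) ... (x^2-(m-1)^2) reads
      x^(2k) = sum over m of R(k,m) B_m(x),
      B_m(x) = C(x+m,2m) + C(x+m-1,2m)    (pow_centralBin).
    Summing over the odd numbers x = 1, 3, ..., 2n-1, the two binomials of B_m
    at these x run through C(y+m,2m) for all 0 <= y < 2n, so the sum is
    C(2n+m,2m+1) by the hockey-stick identity (sum_centralBin).

    The expansion is proved by induction on k from two recurrences,
      x^2 B_m = m^2 B_m + (2m+1)(2m+2) B_(m+1)               (centralBin_rec),
      R(k+1,m+1) = (m+1)^2 R(k,m+1) + (2m+1)(2m+2) R(k,m)    (R_rec),
    which match term by term; the boundary terms disappear because R(k,0) = 0
    and R(k,m) = 0 for m > k >= 1 (R_k0 and R_gt). *)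

(** * Binomial recurrences over the integers *)

(** Over int the factors such as N - p may be negative, but then the binomials
    that they multiply are zero, so these identities need no bound on p. *)
Lemma mulz_bin_right (N p : nat) :
  (p%:Z + 1) * ('C(N, p.+1))%:Z = (N%:Z - p%:Z) * ('C(N, p))%:Z.
Proof.
have := mul_bin_left N p.
case: (leqP p N) => hpN; last by rewrite !bin_small ?mulr0 //; lia.
nia.
Qed.

Lemma mulz_bin_down (N p : nat) :
  (N%:Z + 1 - p%:Z) * ('C(N.+1, p))%:Z = (N%:Z + 1) * ('C(N, p))%:Z.
Proof.
have := mul_bin_down N.+1 p.
case: (leqP p N.+1) => hpN; last by rewrite !bin_small ?mulr0 //; lia.
rewrite /=; nia.
Qed.

Lemma mulz_bin_diag (N p : nat) :
  (p%:Z + 1) * ('C(N.+1, p.+1))%:Z = (N%:Z + 1) * ('C(N, p))%:Z.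
Proof. by have := mul_bin_diag N.+1 p; rewrite /=; nia. Qed.

Lemma mulz_bin_diag_right (N p : nat) :
  (p%:Z + 1) * (p%:Z + 2) * ('C(N.+1, p.+2))%:Z
    = (N%:Z + 1) * (N%:Z - p%:Z) * ('C(N, p))%:Z.
Proof.
have h1 := mulz_bin_diag N p.+1.
rewrite -[RHS]mulrA -mulz_bin_right [RHS]mulrCA -h1; ring.
Qed.

Lemma mulz_bin_diag_down (N p : nat) :
  (p%:Z + 1) * (N%:Z + 1 - p%:Z) * ('C(N.+2, p.+1))%:Z
    = (N%:Z + 1) * (N%:Z + 2) * ('C(N, p))%:Z.
Proof.
rewrite mulrAC mulz_bin_diag.
have -> : (N.+1%:Z + 1) * 'C(N.+1, p)%:Z * (N%:Z + 1 - p%:Z)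
  = (N%:Z + 2) * ((N%:Z + 1 - p%:Z) * 'C(N.+1, p)%:Z) by lia.
by rewrite mulz_bin_down mulrA [(_ + 2) * _]mulrC.
Qed.

(** * The basis of central factorials *)

(** The basis element B_m(x) of the expansion, at x = y + 1, so that x + m - 1
    is y + m without truncated subtraction.  For m >= 1 it is, as a polynomial in x,
    2 x^2 (x^2-1) ... (x^2-(m-1)^2) / (2m)!. *)
Definition centralBin (m y : nat) : int :=
  ('C(y.+1 + m, 2 * m))%:Z + ('C(y + m, 2 * m))%:Z.

(** In terms of central factorials this says that passing from m to m + 1
    multiplies by x^2 - m^2, up to the factorials.  For the binomials, mulz_bin_diag_right turns each
    half of B_(m+1) into a multiple of the corresponding half of B_m, with
    factors (x+1+m)(x-m) and (x+m)(x-1-m); these differ from x^2 - m^2 by x - m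
    and -(x + m), and mulz_bin_down makes the two errors cancel. *)
Lemma centralBin_rec (m y : nat) :
  (y%:Z + 1) ^+ 2 * centralBin m y =
    m%:Z ^+ 2 * centralBin m y
    + (2 * m%:Z + 1) * (2 * m%:Z + 2) * centralBin m.+1 y.
Proof.
rewrite /centralBin.
have -> : (2 * m.+1 = (2 * m).+2)%N by lia.
have -> : (y.+1 + m.+1 = (y + m).+2)%N by lia.
have -> : (y + m.+1 = (y + m).+1)%N by lia.
have -> : (y.+1 + m = (y + m).+1)%N by lia.
have := mulz_bin_diag_right (y + m).+1 (2 * m).
have := mulz_bin_diag_right (y + m) (2 * m).
have := mulz_bin_down (y + m) (2 * m).
move: ('C((y + m).+2, _)) ('C((y + m).+1, (2 * m).+2)) => c' b'.
move: ('C((y + m).+1, _)) ('C(y + m, _)) => c b.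
nia.
Qed.

(** * The coefficients R(k,m) *)

(** Write one factor (m-j)^2 of the summand as m^2 - j(2m-j): the first part
    reproduces R(k,m), and j(2m-j) C(2m,j) = 2m(2m-1) C(2m-2,j-1) turns the
    second one into R(k,m-1) after the shift of j.  Here m stands for the
    m + 1 of the statement. *)
Lemma R_rec (k m : nat) :
  R k.+1 m.+1 = m.+1%:Z ^+ 2 * R k m.+1
    + (2 * m%:Z + 1) * (2 * m%:Z + 2) * R k m.
Proof.
rewrite /R 2!big_distrr /= !(big_nat_recl m.+1) //= -addrA -big_split /=.
congr (_ + _).
  by rewrite expr0 !subr0 !bin0 !mulr1 !mul1r -exprD; congr (_ ^+ _); lia.
apply: eq_bigr => j _.
have h := mulz_bin_diag_down (2 * m) j.
have -> : (2 * m.+1 = (2 * m).+2)%N by lia.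
have -> : (2 * k.+1 = 2 + 2 * k)%N by lia.
have -> : m.+1%:Z - j.+1%:Z = m%:Z - j%:Z by lia.
rewrite exprD exprS.
set s := (-1) ^+ j; set P := _ ^+ (2 * k).
have -> : (m%:Z - j%:Z) ^+ 2 = m.+1%:Z ^+ 2 - (j%:Z + 1) * ((2 * m)%N%:Z + 1 - j%:Z).
  by ring.
have -> : (-1 * s) * 'C((2 * m).+2, j.+1)%:Z
   * ((m.+1%:Z ^+ 2 - (j%:Z + 1) * ((2 * m)%N%:Z + 1 - j%:Z)) * P)
  = m.+1%:Z ^+ 2 * (-1 * s * 'C((2 * m).+2, j.+1)%:Z * P)
    + s * P * ((j%:Z + 1) * ((2 * m)%N%:Z + 1 - j%:Z) * 'C((2 * m).+2, j.+1)%:Z).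
  by ring.
by rewrite h; ring.
Qed.

Lemma alt_bin_sum (N p : nat) :
  \sum_(0 <= j < p.+1) (-1) ^+ j * ('C(N.+1, j))%:Z = (-1) ^+ p * ('C(N, p))%:Z :> int.
Proof.
elim: p => [|p IHp]; first by rewrite big_nat1 !bin0.
by rewrite big_nat_recr //= IHp binS exprS PoszD; ring.
Qed.

(** At k = 0 the sum does not vanish for large m: it is a truncated alternating
    row sum.  This value starts the recurrence. *)
Lemma R0_S (m : nat) : R 0 m.+1 = (-1) ^+ m.+1 * ('C((2 * m).+1, m.+1))%:Z.
Proof.
rewrite -alt_bin_sum /R.
have -> : (2 * m.+1 = (2 * m).+2)%N by lia.
by apply: eq_bigr => j _; rewrite muln0 expr0 mulr1.
Qed.

Lemma R_k0 (k : nat) : R k.+1 0 = 0.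
Proof. by rewrite /R big_nat1 mulnS expr0 subrr exprS mul0r mulr0. Qed.

(** By R_rec and R0_S this is (m+2)^2 C(2m+3,m+2) = (2m+3)(2m+4) C(2m+1,m+1),
    where C(2m+2,m+1) = 2 C(2m+1,m+1) is the intermediate step. *)
Lemma R1_SS (m : nat) : R 1 m.+2 = 0.
Proof.
rewrite R_rec !R0_S.
have := mulz_bin_diag (2 * m.+1) m.+1.
have := mulz_bin_down (2 * m).+1 m.+1.
have -> : (2 * m.+1 = (2 * m).+2)%N by lia.
rewrite [(-1) ^+ m.+2]exprS.
move: ((-1) ^+ m.+1) ('C((2 * m).+3, m.+2)) ('C((2 * m).+2, m.+1)) => s a b.
move: ('C((2 * m).+1, m.+1)) => c h1 h2.
have hb : b%:Z = 2 * c%:Z by nia.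
have ha : (m%:Z + 2) * a%:Z = (2 * m%:Z + 3) * b%:Z by nia.
have -> : m.+2%:Z ^+ 2 * (-1 * s * a%:Z) = - ((m%:Z + 2) * s * ((m%:Z + 2) * a%:Z)).
  by ring.
by rewrite ha hb; ring.
Qed.

(** Both terms of R_rec vanish by induction on k, which has to start at the first
    power because R(0,m) is not zero. *)
Lemma R_gt (k m : nat) : (k < m)%N -> R k.+1 m.+1 = 0.
Proof.
elim: k m => [|k IHk] [|m] //; first by rewrite R1_SS.
by move=> hkm; rewrite R_rec !IHk ?mulr0 //; lia.
Qed.

(** * Expansion of even powers and summation *)

(** Multiplying the expansion for k by x^2 and using centralBin_rec produces m^2
    times each term and a term shifted from m to m + 1; collecting the
    coefficients of B_(m+1) gives the right side of R_rec. *)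
Lemma pow_centralBin (k y : nat) :
  (y%:Z + 1) ^+ (2 * k.+1) = \sum_(0 <= m < k.+2) R k.+1 m * centralBin m y.
Proof.
elim: k => [|k IHk].
  rewrite !big_nat_recr //= big_nil R_k0 /centralBin.
  rewrite /R !big_nat_recr //= big_nil.
  have := mulz_bin_diag_right y.+1 0.
  have := mulz_bin_diag_right y 0.
  rewrite muln1 addn1 addn1 !bin0 !bin1.
  nia.
have -> : (2 * k.+2 = 2 + 2 * k.+1)%N by lia.
rewrite exprD IHk big_distrr /=.
rewrite [RHS](big_nat_recl k.+2) //= R_k0 mul0r add0r.
transitivity (\sum_(0 <= m < k.+2) m%:Z ^+ 2 * (R k.+1 m * centralBin m y)
  + \sum_(0 <= m < k.+2)
      (2 * m%:Z + 1) * (2 * m%:Z + 2) * R k.+1 m * centralBin m.+1 y).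
  rewrite -big_split /=; apply: eq_bigr => m _.
  by rewrite mulrCA centralBin_rec; ring.
(* The term m = 0 vanishes because of m^2, and the new last term m = k + 2
   because R(k+1,k+2) = 0. *)
have -> : \sum_(0 <= m < k.+2) m%:Z ^+ 2 * (R k.+1 m * centralBin m y)
  = \sum_(0 <= m < k.+2) m.+1%:Z ^+ 2 * (R k.+1 m.+1 * centralBin m.+1 y).
  rewrite [LHS](big_nat_recl k.+1) //= expr0n mul0r add0r.
  by rewrite [RHS](big_nat_recr k.+1) //= R_gt // mul0r mulr0 addr0.
rewrite -big_split /=; apply: eq_bigr => m _.
by rewrite [R k.+2 _]R_rec; ring.
Qed.

(** Here y = 2i means x = 2i + 1.  Each B_m(2i+1) is the sum of two consecutive
    terms of the hockey-stick sum of C(y+m,2m), so advancing n by one is two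
    applications of Pascal's rule. *)
Lemma sum_centralBin (m n : nat) :
  \sum_(0 <= i < n) centralBin m (2 * i) = ('C(2 * n + m, 2 * m + 1))%:Z.
Proof.
elim: n => [|n IHn].
  by rewrite big_nil bin_small //; lia.
rewrite big_nat_recr //= IHn /centralBin.
have -> : (2 * n.+1 + m = ((2 * n + m).+1).+1)%N by lia.
have -> : ((2 * n).+1 + m = (2 * n + m).+1)%N by lia.
by rewrite addn1 !binS !PoszD; ring.
Qed.

Theorem mainTheorem4 (k n : nat) (hk : (1 <= k)%N) (hn : (1 <= n)%N) :
  (oddPowerSum (2 * k) n)%:Z =
  \sum_(1 <= m < k.+1) R k m * ('C(2 * n + m, 2 * m + 1))%:Z.
Proof.
case: k hk => // k _.
rewrite /oddPowerSum big_add1 /=.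
transitivity (\sum_(0 <= i < n) ((2 * i)%N%:Z + 1) ^+ (2 * k.+1)).
  rewrite (big_morph Posz PoszD (erefl _)).
  apply: eq_bigr => i _; rewrite -!natz natrX; congr (_ ^+ _); lia.
rewrite (eq_bigr _ (fun i _ => pow_centralBin k (2 * i))).
rewrite exchange_big /= (big_nat_recl k.+1) //= R_k0.
rewrite big1 ?add0r; last by move=> i _; rewrite mul0r.
rewrite big_add1 /=; apply: eq_bigr => m _.
by rewrite -big_distrr /= sum_centralBin.
Qed.
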